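(* Let $G=(V,E)$ be a connected graph. Consider the following algorithm, run on input $G$, which maintains a set $S^*$ and a stack $A$ of pairs $(S,U)$ of vertex subsets: 1. Set $S^*\leftarrow\emptyset$; let $C$ be the set of cut-vertices of $G$; initialize the stack $A$ to contain the single pair $(\emptyset, V\setminus C)$. 2. While $A$ is nonempty: pop a pair $(S,U)$ from $A$; then, while $U\neq\emptyset$ and $|S^*|<|S|+k(U)$, where $k(U)$ is the number of colors used by a greedy proper vertex coloring of the complement graph $\overline{G[U]}$, do: remove some vertex $v$ from $U$; push $(S,U)$ onto $A$; set $S\leftarrow S\cup\{v\}$; let $C$ be the set of cut-vertices of the graph $G\setminus S$ obtained from $G$ by deleting $S$; set $U\leftarrow (U\cap \overline N(v))\setminus C$, where $\overline N(v)$ is the set of vertices not adjacent to $v$; if $|S|>|S^*|$ set $S^*\leftarrow S$. 3. Return $V\setminus S^*$. Then the algorithm outputs a minimum-cardinality connected vertex cover of $G$.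
   Context: A set $C\subseteq V$ is a vertex cover of $G$ if every edge of $G$ has at least one endpoint in $C$; it is a connected vertex cover if moreover the induced subgraph $G[C]$ is connected. A vertex $v$ of a connected graph $H$ is a cut-vertex if deleting $v$ disconnects $H$ (for a graph that is not connected, cut-vertices are taken with respect to its connected components). A greedy proper coloring of a graph assigns colors to vertices one at a time, each receiving a color not used on its already-colored neighbors. *)

(* Defs.v *)
From Stdlib Require Export Relation_Operators.
From mathcomp Require Export all_boot.

Set Implicit Arguments.
Unset Strict Implicit.
Unset Printing Implicit Defensive.

(** A finite simple graph is a symmetric irreflexive [e : rel T] on the vertex
    type [T : finType]; subgraphs are always induced by some [W : {set T}]. *)
Section Graphs.
Variables (T : finType) (e : rel T).
Implicit Types (C S U W : {set T}) (v x y : T).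

Definition induced W : rel T := [rel x y in W | e x y].

(** The empty graph counts as connected.  This matters only when the whole
    graph has at most one vertex: the one-vertex graph has the vertex cover
    [set0], and its vertex is not a cut-vertex. *)
Definition connected_on W : bool :=
  [forall x in W, forall y in W, connect (induced W) x y].

Definition component W v : {set T} := [set x in W | connect (induced W) v x].

Definition cut_vertices W : {set T} :=
  [set v in W | ~~ connected_on (component W v :\ v)].

Definition vertex_cover C : bool :=
  [forall x, forall y, e x y ==> (x \in C) || (y \in C)].

Definition connected_vertex_cover C : bool :=
  vertex_cover C && connected_on C.

Definition minimum_connected_vertex_cover C : Prop :=
  connected_vertex_cover C /\
  forall D : {set T}, connected_vertex_cover D -> #|C| <= #|D|.

Definition complement_induced U : rel T :=
  [rel x y in U | (x != y) && ~~ e x y].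

Definition non_neighbours v : {set T} := [set x | ~~ e v x].

End Graphs.

(** The vertices of [W] are coloured in the order of some enumeration [s], each
    vertex [x] getting any colour that differs from those of the neighbours [y]
    preceding it in [s].  First-fit colouring is one such choice. *)
Definition greedy_coloring (T : finType) (f : rel T) (W : {set T})
    (c : T -> nat) : Prop :=
  exists s : seq T,
    [/\ uniq s, s =i W & pairwise [rel y x | f x y ==> (c x != c y)] s].

Definition greedy_number (T : finType) (f : rel T) (W : {set T})
    (k : nat) : Prop :=
  exists2 c : T -> nat,
    greedy_coloring f W c & k = size (undup [seq c x | x in W]).

(** Control points of the algorithm: [Outer Sbest A] is the test of the outer
    loop, [Inner Sbest A S U] the test of the inner loop, with [Sbest] the set
    written S* and the top of the stack [A] at its head. *)
Inductive state (T : finType) : Type :=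
  | Outer of {set T} & seq ({set T} * {set T})
  | Inner of {set T} & seq ({set T} * {set T}) & {set T} & {set T}
  | Returned of {set T}.

Section Algorithm.
Variables (T : finType) (e : rel T).
Implicit Types (Sbest S U : {set T}) (A : seq ({set T} * {set T})).

Definition init : state T :=
  Outer set0 [:: (set0, [set: T] :\: cut_vertices e [set: T])].

Definition loop_test Sbest S U (k : nat) : bool :=
  (U != set0) && (#|Sbest| < #|S| + k).

(** The choice of [v] and of the greedy colouring are left nondeterministic at
    each iteration. *)
Inductive step : state T -> state T -> Prop :=
  | step_return Sbest :
      step (Outer Sbest [::]) (Returned ([set: T] :\: Sbest))
  | step_pop Sbest A S U :
      step (Outer Sbest ((S, U) :: A)) (Inner Sbest A S U)
  | step_exit Sbest A S U k :
      greedy_number (complement_induced e U) U k ->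
      ~~ loop_test Sbest S U k ->
      step (Inner Sbest A S U) (Outer Sbest A)
  | step_body Sbest A S U k v :
      greedy_number (complement_induced e U) U k ->
      loop_test Sbest S U k ->
      v \in U ->
      let U1 := U :\ v in
      let S' := v |: S in
      let U' := (U1 :&: non_neighbours e v) :\: cut_vertices e (~: S') in
      let Sbest' := if #|Sbest| < #|S'| then S' else Sbest in
      step (Inner Sbest A S U) (Inner Sbest' ((S, U1) :: A) S' U').

Definition reachable : state T -> state T -> Prop := clos_refl_trans _ step.

(** Every run from [st] is finite. *)
Definition terminates (st : state T) : Prop := Acc (fun y x => step x y) st.

Definition halted (st : state T) : Prop := forall st', ~ step st st'.

End Algorithm.

(* Main.v *)
Require Import Defs.
From mathcomp Require Import all_boot.

(** Complements of connected vertex covers are the independent sets [I] with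
    [G \ I] connected, so the algorithm has to find such a set of maximum size.
    If [G \ S] is connected and [S] is contained in such an [I], then no vertex
    [v] of [I \ S] is a cut-vertex of [G \ S]: the set [~: I] is connected, and
    every other vertex of [I \ S] has a neighbour in [G \ S], which lies in
    [~: I] because [I] is independent.  Hence discarding cut-vertices loses no
    candidate, while each [S] that is visited remains independent with connected
    complement.  Pruning is sound since [I \ S] is a clique of the complement
    graph and therefore uses [#|I :\: S|] colours. *)

Set Implicit Arguments.
Unset Strict Implicit.
Unset Printing Implicit Defensive.

Section GraphFacts.
Variables (T : finType) (e : rel T).
Hypotheses (e_sym : symmetric e) (e_irr : irreflexive e).
Implicit Types (C D I J S Sbest U W : {set T}) (v x y : T).

(** * Independent sets, connectivity and cut-vertices *)

Definition independent I : bool :=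
  [forall x in I, forall y in I, ~~ e x y].

Lemma independentP I :
  reflect {in I &, forall x y, ~~ e x y} (independent I).
Proof.
apply: (iffP forall_inP) => [H x y xI yI | H x xI].
  by move/forall_inP: (H x xI); apply.
by apply/forall_inP => y yI; apply: H.
Qed.

Lemma connected_onP W :
  reflect {in W &, forall x y, connect (induced e W) x y} (connected_on e W).
Proof.
apply: (iffP forall_inP) => [H x y xW yW | H x xW].
  by move/forall_inP: (H x xW); apply.
by apply/forall_inP => y yW; apply: H.
Qed.

Lemma vertex_coverE C : vertex_cover e C = independent (~: C).
Proof.
apply/forallP/independentP => [H x y | H x].
  rewrite !inE => /negbTE xC /negbTE yC.
  by move/forallP/(_ y): (H x); rewrite xC yC implybF.
apply/forallP => y; apply/implyP; apply: contraLR.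
by rewrite negb_or => /andP[xC yC]; apply: H; rewrite inE.
Qed.

Lemma connect_induced_sym W : connect_sym (induced e W).
Proof.
by apply: sym_connect_sym => x y; rewrite /induced /= e_sym [in RHS](andbC (y \in W)).
Qed.

Lemma connect_inducedS W1 W2 :
  W1 \subset W2 -> subrel (connect (induced e W1)) (connect (induced e W2)).
Proof.
move=> /subsetP sW; apply: connect_sub => x y /= /andP[/andP[xW yW] exy].
by apply: connect1; rewrite /induced /= !sW.
Qed.

Lemma component_connected W v :
  connected_on e W -> v \in W -> component e W v = W.
Proof.
move=> /connected_onP cW vW; apply/setP => x; rewrite inE.
by case: (boolP (x \in W)) => //= xW; apply: cW.
Qed.

Lemma connected_on_setD1 W v :
  connected_on e W -> v \notin cut_vertices e W -> connected_on e (W :\ v).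
Proof.
move=> cW; rewrite inE; case: (boolP (v \in W)) => [vW | vW _].
  by rewrite component_connected //= negbK.
by rewrite (setDidPl _) // disjoint_sym disjoints1.
Qed.

Lemma not_cut_vertex W J v :
    connected_on e W -> independent J -> J \subset W ->
    connected_on e (W :\: J) -> v \in J ->
  v \notin cut_vertices e W.
Proof.
move=> cW /independentP iJ /subsetP sJW /connected_onP cWJ vJ.
have vW := sJW v vJ.
rewrite inE vW component_connected //= negbK; apply/connected_onP.
have sub : W :\: J \subset W :\ v by apply: setDS; rewrite sub1set.
have toD x : x \in W :\ v ->
    exists2 x', x' \in W :\: J & connect (induced e (W :\ v)) x x'.
  move=> xWv; have := xWv; rewrite !inE => /andP[xv xW].
  case: (boolP (x \in J)) => xJ; last first.
    by exists x; rewrite ?connect0 // inE xJ.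
  (* Only the first step [y] of a path from [x] to [v] in [W] matters: [x] lies in the independent
     set [J], so its neighbour [y] does not, and in particular [y] differs from [v]. *)
  have /connectP[[|y p] /= ] := (connected_onP _ cW) x v xW vW.
    by move=> _ vx; rewrite vx eqxx in xv.
  move=> /andP[/andP[/andP[_ yW] exy] _] _.
  have yWJ : y \in W :\: J.
    by rewrite inE yW andbT; apply: contraL exy => yJ; apply: iJ.
  by exists y => //; apply: connect1; rewrite /induced /= xWv (subsetP sub).
move=> x y /toD[x' x'W xx'] /toD[y' y'W yy'].
apply: connect_trans xx' _.
apply: connect_trans (_ : connect _ x' y') _; last by rewrite connect_induced_sym.
by apply: connect_inducedS sub _ _ _; apply: cWJ.
Qed.

(** * Greedy colourings *)

Lemma greedy_number_ex (f : rel T) W : exists k, greedy_number f W k.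
Proof.
exists (size (undup [seq nat_of_ord (enum_rank x) | x in W])).
exists (fun x => nat_of_ord (enum_rank x)) => //; exists (enum W).
split; [exact: enum_uniq | exact: mem_enum |].
have := enum_uniq W; rewrite uniq_pairwise; apply: sub_pairwise => x y /=.
by move=> xy; rewrite (inj_eq val_inj) (inj_eq enum_rank_inj) eq_sym xy implybT.
Qed.

Lemma independent_leq_greedy_number U J k :
    greedy_number (complement_induced e U) U k ->
    independent J -> J \subset U ->
  #|J| <= k.
Proof.
case=> c [s [_ sU pw] ->] /independentP iJ /subsetP sJU.
have c_inj : {in J &, injective c}.
  move=> x y xJ yJ /eqP cxy; apply/eqP; apply: contraTT cxy => xy.
  have adj a b : a \in J -> b \in J -> a != b -> complement_induced e U a b.
    by move=> aJ bJ ab; rewrite /complement_induced /= !sJU //= ab iJ.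
  have xs : x \in s by rewrite sU sJU.
  have ys : y \in s by rewrite sU sJU.
  (* The colouring condition is oriented by the order of [s]; whichever of [x] and [y] comes first
     selects the disjunct. *)
  have /orP[/implyP|/implyP] :
      (complement_induced e U x y ==> (c x != c y)) ||
      (complement_induced e U y x ==> (c y != c x)).
  - move/(pairwiseP x): pw => pw.
    have xi : index x s < size s by rewrite index_mem.
    have yi : index y s < size s by rewrite index_mem.
    have [lt | lt | eqi] := ltngtP (index x s) (index y s).
    + by have := pw _ _ xi yi lt; rewrite /= !nth_index // => ->; rewrite orbT.
    + by have := pw _ _ yi xi lt; rewrite /= !nth_index // => ->.
    + by move: xy; rewrite -(nth_index x xs) eqi nth_index // eqxx.
  - by apply; apply: adj.
  - by rewrite eq_sym; apply; apply: adj => //; rewrite eq_sym.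
rewrite -(size_image c J); apply: uniq_leq_size.
  by rewrite map_inj_in_uniq ?enum_uniq // => x y; rewrite !mem_enum; apply: c_inj.
move=> _ /imageP[x xJ ->]; rewrite mem_undup; apply: image_f; exact: sJU.
Qed.

(** * The search invariant *)

Definition feasible S : bool := independent S && connected_on e (~: S).

Lemma connected_vertex_coverE C : connected_vertex_cover e C = feasible (~: C).
Proof. by rewrite /connected_vertex_cover vertex_coverE /feasible setCK. Qed.

(** The size bound settles an exit with [p.2] empty, where every covered set lies in [p.1]. The last
    clause lets any vertex of [p.2] join [p.1] without losing feasibility. *)
Definition sound_node Sbest (p : {set T} * {set T}) : Prop :=
  [/\ feasible p.1, #|p.1| <= #|Sbest| &
      {in p.2, forall v, (v \notin cut_vertices e (~: p.1)) /\
                         {in p.1, forall x, ~~ e v x}}].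

Definition covers I (p : {set T} * {set T}) : bool :=
  (p.1 \subset I) && (I \subset p.1 :|: p.2).

(** A candidate may leave the search only once [Sbest] is at least as large, so an empty stack makes
    [Sbest] optimal. *)
Definition search_inv Sbest (A : seq ({set T} * {set T})) : Prop :=
  [/\ feasible Sbest, {in A, forall p, sound_node Sbest p} &
      forall I, feasible I -> (#|I| <= #|Sbest|) || has (covers I) A].

(** The pair under expansion counts as still being on the stack, so a pop changes nothing. *)
Definition state_inv (st : state T) : Prop :=
  match st with
  | Outer Sbest A => search_inv Sbest A
  | Inner Sbest A X U => search_inv Sbest ((X, U) :: A)
  | Returned C => minimum_connected_vertex_cover e C
  end.

Lemma independent_sub I J : J \subset I -> independent I -> independent J.
Proof.
move=> /subsetP sJI /independentP iI; apply/independentP => x y xJ yJ.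
by apply: iI; apply: sJI.
Qed.

Lemma feasible_not_cut_vertex S I v :
    connected_on e (~: S) -> feasible I -> S \subset I -> v \in I :\: S ->
  v \notin cut_vertices e (~: S).
Proof.
move=> cS /andP[iI cI] sSI; apply: not_cut_vertex => //.
- by apply: independent_sub iI; apply: subsetDl.
- by rewrite setDE subsetIr.
(* Since [S] is contained in [I], removing [I :\: S] from [~: S] leaves [~: I], which is
   connected. *)
- by rewrite setDE setCD setIUr [~: S :&: S]setIC setICr setU0 -setCU (setUidPr sSI).
Qed.

Lemma state_inv_init : connected_on e [set: T] -> state_inv (init e).
Proof.
move=> cT; have f0 : feasible set0.
  by rewrite /feasible setC0 cT andbT; apply/independentP => x y; rewrite inE.
split=> // [p | I fI].
  rewrite inE => /eqP-> /=; split=> //= v; rewrite inE => /andP[vC _].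
  by rewrite setC0; split=> // x; rewrite inE.
apply/orP; right; rewrite /= orbF /covers /= sub0set set0U /=.
apply/subsetP => v vI; rewrite in_setD in_setT andbT -setC0.
by apply: feasible_not_cut_vertex fI (sub0set I) _; rewrite ?setC0 ?setD0.
Qed.

Lemma state_inv_exit Sbest A S U k :
    greedy_number (complement_induced e U) U k -> ~~ loop_test Sbest S U k ->
  state_inv (Inner Sbest A S U) -> state_inv (Outer Sbest A).
Proof.
move=> gk; rewrite negb_and negbK -leqNgt => stop [fb sound cov].
split=> // [p pA | I fI]; first by apply: sound; rewrite inE pA orbT.
have /orP[-> // | /= /orP[/andP[/= sSI sIU] | -> ]] := cov I fI; last by rewrite orbT.
apply/orP; left.
have sDU : I :\: S \subset U by rewrite subDset.
have [_ /= leS _] := sound (S, U) (mem_head _ _).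
(* If [U] is empty then [I] lies in [S]; otherwise [I] has at most [#|S| + k] elements, by the bound
   on [I :\: S]. *)
case/orP: stop => [/eqP U0 | ].
  by apply: leq_trans leS; rewrite U0 setU0 in sIU; apply: subset_leq_card.
apply: leq_trans; rewrite -(cardsID S I) (setIidPr sSI) leq_add2l.
apply: independent_leq_greedy_number gk _ sDU.
by case/andP: fI => iI _; apply: independent_sub iI; apply: subsetDl.
Qed.

Lemma feasible_setU1 Sbest S U v :
  sound_node Sbest (S, U) -> v \in U -> feasible (v |: S).
Proof.
case=> /= /andP[/independentP iS cS] _ sU /sU[vC vS].
apply/andP; split; last by rewrite setCU setIC -setDE connected_on_setD1.
apply/independentP => x y /setU1P[-> | xS] /setU1P[-> | yS].
- by rewrite e_irr.
- exact: vS.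
- by rewrite e_sym vS.
- exact: iS.
Qed.

(** The two top pairs split the candidates of [(S, U)]: those avoiding [v] stay with [(S, U1)],
    those containing [v] pass to [(S', U')]. *)
Lemma state_inv_body Sbest A S U v :
    v \in U -> state_inv (Inner Sbest A S U) ->
    let U1 := U :\ v in
    let S' := v |: S in
    let U' := (U1 :&: non_neighbours e v) :\: cut_vertices e (~: S') in
    let Sbest' := if #|Sbest| < #|S'| then S' else Sbest in
  state_inv (Inner Sbest' ((S, U1) :: A) S' U').
Proof.
move=> vU [fb sound cov] U1 S' U' Sbest'.
have soundSU := sound _ (mem_head _ _).
have fS' : feasible S' by apply: feasible_setU1 soundSU vU.
have [leb leS'] : #|Sbest| <= #|Sbest'| /\ #|S'| <= #|Sbest'|.
  by rewrite /Sbest'; case: ltnP => // /ltnW.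
have weaken p : sound_node Sbest p -> sound_node Sbest' p.
  by case=> fp lep Hp; split=> //; apply: leq_trans lep leb.
split; first by rewrite /Sbest'; case: ifP.
- move=> p; rewrite !inE => /or3P[/eqP-> | /eqP-> | pA].
  + split=> //= x /setDP[/setIP[/setD1P[_ xU]]].
    rewrite inE => vx xC; split=> //.
    have [_ _ /(_ x xU)[_ xS]] := soundSU.
    by move=> y /setU1P[-> | /xS //]; rewrite e_sym.
  + have [fS leS sU] := weaken _ soundSU; split=> //= x.
    by move=> /setD1P[_ xU]; apply: sU.
  + by apply/weaken/sound; rewrite inE pA orbT.
- move=> I fI.
  have /orP[leI | /= /orP[/andP[/= sSI sIU] | ->]] := cov I fI; last by rewrite !orbT.
    by rewrite (leq_trans leI).
  apply/orP; right.
  case: (boolP (v \in I)) => vI; last first.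
    apply/orP; right; apply/orP; left; rewrite /covers /= sSI /=.
    apply/subsetP => x xI; have := subsetP sIU x xI; rewrite !inE.
    by have -> : x != v by apply: contraNneq vI => <-.
  have sS'I : S' \subset I by rewrite subUset sub1set vI.
  apply/orP; left; rewrite /covers /= sS'I /=.
  apply/subsetP => x xI; rewrite in_setU.
  (* A remaining [x] of [I] survives both filters: it is no cut-vertex because [I] is feasible and
     contains [S'], and it is not adjacent to [v] because [I] is independent. *)
  case: (boolP (x \in S')) => //= xS'; rewrite inE.
  have -> : x \notin cut_vertices e (~: S').
    by case/andP: fS' => _ cS'; apply: feasible_not_cut_vertex sS'I _; rewrite // inE xS'.
  move: xS'; rewrite !inE negb_or => /andP[-> xS].
  have := subsetP sIU x xI; rewrite inE (negbTE xS) => /= ->.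
  by case/andP: fI => /independentP iI _; apply: iI.
Qed.

Lemma state_inv_return Sbest :
  search_inv Sbest [::] -> minimum_connected_vertex_cover e ([set: T] :\: Sbest).
Proof.
case=> fb _ cov; rewrite setTD; split=> [|D]; rewrite connected_vertex_coverE ?setCK //.
(* A set and its complement have [#|T|] elements together, so the largest feasible set leaves the
   smallest cover. *)
by move/cov; rewrite orbF -(leq_add2l #|D|) cardsC -(cardsC Sbest) addnC leq_add2r.
Qed.

Lemma state_inv_step st st' : step e st st' -> state_inv st -> state_inv st'.
Proof.
case=> {st st'}.
- exact: state_inv_return.
- by [].
- exact: state_inv_exit.
- by move=> Sbest A S U k v _ _ vU inv; apply: state_inv_body.
Qed.

Lemma state_inv_reachable st st' :
  reachable e st st' -> state_inv st -> state_inv st'.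
Proof. by elim=> {st st'} [st st' /state_inv_step | | st st' st'' _ H _ H' /H]. Qed.

(** * Halting and termination *)

Lemma halted_returned st : halted e st -> exists C, st = Returned C.
Proof.
case: st => [Sbest [|[S U] A] | Sbest A S U | C] H; last by exists C.
- by case: (H _ (step_return _ _)).
- by case: (H _ (step_pop _ _ _ _ _)).
have [k gk] := greedy_number_ex (complement_induced e U) U.
case: (boolP (loop_test Sbest S U k)) => [lt | stop].
  have /andP[/set0Pn[v vU] _] := lt.
  by case: (H _ (step_body A gk lt vU)).
by case: (H _ (step_exit A gk stop)).
Qed.

(* Base 3 because the body of the inner loop replaces [U] by two sets that are
   smaller by at least one element. *)
Definition stack_measure (A : seq ({set T} * {set T})) : nat :=
  \sum_(p <- A) 3 ^ #|p.2|.+1.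

(** The successor at [Outer] makes a pop decrease the measure. An exit pays it back, since the
    discarded pair weighs at least 3, even with [U] empty, thanks to the [.+1] in the exponent. *)
Definition state_measure (st : state T) : nat :=
  match st with
  | Outer _ A => (stack_measure A).+1
  | Inner _ A X U => stack_measure ((X, U) :: A)
  | Returned _ => 0
  end.

Lemma state_measure_step st st' :
  step e st st' -> state_measure st' < state_measure st.
Proof.
case=> {st st'} //=.
- move=> _ A S U k _ _; rewrite /stack_measure big_cons /= -addn2 addnC leq_add2r.
  by rewrite expnS (leq_trans _ (leq_pmulr 3 _)) // expn_gt0.
- move=> Sbest A S U k v _ _ vU; rewrite /stack_measure !big_cons /= addnA ltn_add2r.
  have -> : #|U| = #|U :\ v|.+1 by rewrite (cardsD1 v U) vU.
  set W := (_ :\: _); have leW : #|W| <= #|U :\ v|.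
    by apply: subset_leq_card; apply: subset_trans (subsetDl _ _) (subsetIl _ _).
  apply: (@leq_ltn_trans (2 * 3 ^ #|U :\ v|.+1)).
    by rewrite mul2n -addnn leq_add2r leq_exp2l.
  by rewrite [ltnRHS]expnS ltn_pmul2r // expn_gt0.
Qed.

Lemma terminates_all st : terminates e st.
Proof.
have [n le_n] := ubnP (state_measure st).
elim: n st le_n => [st | n IHn st le_n]; first by rewrite ltn0.
apply: Acc_intro => st' st_st'; apply: IHn.
exact: leq_trans (state_measure_step st_st') _.
Qed.

End GraphFacts.

Theorem theorem2 (T : finType) (e : rel T)
    (e_sym : symmetric e) (e_irr : irreflexive e)
    (e_conn : connected_on e [set: T]) :
  terminates e (init e) /\
  (forall st : state T, reachable e (init e) st -> halted e st ->
     exists C : {set T},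
       st = Returned C /\ minimum_connected_vertex_cover e C).
Proof.
split=> [|st reach /halted_returned[C st_C]]; first exact: terminates_all.
exists C; split=> //.
have /= := state_inv_reachable e_sym e_irr reach (state_inv_init e_sym e_conn).
by rewrite st_C.
Qed.
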